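(* Let $d$ be a positive integer with $d>1$, and let $T$ be a tree with $n$ vertices whose diameter is at least $d$. If $T\ne T(n,d)$ (i.e. $T$ is not isomorphic to $T(n,d)$), then $$\chi(T)<\chi(T(n,d)).$$
   Context: All trees are finite and unweighted. A subtree of a tree $T$ is a nonempty connected subgraph of $T$ (single vertices are allowed), and $\chi(T)$ denotes the number of subtrees of $T$. For $n\ge d+1$, let $P_{d+1}$ be the path with vertex set $\{1,2,\ldots,d+1\}$ and edges $(i,i+1)$ for $i=1,\ldots,d$. $T(n,d)$ is the tree with $n$ vertices obtained from $P_{d+1}$ by attaching $n-d-1$ pendant edges (each with a new leaf) to the vertex $\lfloor\frac{d+1}{2}\rfloor+1$. The diameter is the maximum number of edges in a path of the tree. *)

(* Defs.v *)
From mathcomp Require Import all_boot.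

Set Implicit Arguments.
Unset Strict Implicit.
Unset Printing Implicit Defensive.

Record sgraph := SGraph {
  vertex :> finType;
  adj : rel vertex;
  adj_sym : symmetric adj;
  adj_irr : irreflexive adj }.

Definition isomorphic (G H : sgraph) : Prop :=
  exists f : G -> H, bijective f /\ forall x y, adj (f x) (f y) = adj x y.

(* The only duplicate-free closed walks of length at most 2 are the empty one
   and the traversals of a single edge back and forth, hence the bound 2. *)
Definition is_tree (G : sgraph) : Prop :=
  [/\ 0 < #|G|,
      forall x y : G, connect (@adj G) x y
    & forall c : seq G, ucycle (@adj G) c -> size c <= 2].

Definition edges (G : sgraph) : {set {set G}} :=
  [set E | [exists x, exists y, adj x y && (E == [set x; y])]].

(* A subgraph is a pair (vertex set, edge set).  As its edges join vertices of
   H.1, paths along H.2 between vertices of H.1 do not leave H.1. *)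
Definition is_subgraph (G : sgraph) (H : {set G} * {set {set G}}) : bool :=
  (H.2 \subset edges G) && [forall E in H.2, E \subset H.1].

Definition is_subtree (G : sgraph) (H : {set G} * {set {set G}}) : bool :=
  [&& is_subgraph H, H.1 != set0 &
      [forall x in H.1, forall y in H.1,
         connect [rel u v | [set u; v] \in H.2] x y]].

Definition chi (G : sgraph) : nat :=
  #|[set H : {set G} * {set {set G}} | is_subtree H]|.

(* A path with k edges is x :: t with t of size k and no repeated vertex; such
   a path has k.+1 vertices, so the range k < #|G| omits none. *)
Definition diameter (G : sgraph) : nat :=
  \max_(k < #|G| | [exists x : G, exists t : k.-tuple G,
                      path (@adj G) x t && uniq (x :: t)]) k.

(* inl i is the vertex i + 1 of P_(d+1), so the vertex floor((d+1)/2) + 1 is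
   inl (d.+1)./2; the inr's are the n - d - 1 added leaves.  Only d < n is
   meaningful. *)
Definition Tnd_adj (n d : nat) (x y : 'I_d.+1 + 'I_(n - d.+1)) : bool :=
  match x, y with
  | inl i, inl j => (i.+1 == j :> nat) || (j.+1 == i :> nat)
  | inl i, inr _ | inr _, inl i => i == (d.+1)./2 :> nat
  | inr _, inr _ => false
  end.

Lemma Tnd_adj_sym (n d : nat) : symmetric (@Tnd_adj n d).
Proof. by move=> [i|i] [j|j] //=; rewrite orbC. Qed.

Lemma Tnd_adj_irr (n d : nat) : irreflexive (@Tnd_adj n d).
Proof. by move=> [i|i] //=; rewrite orbb eqn_leq ltnn. Qed.

Definition Tnd (n d : nat) : sgraph :=
  SGraph (@Tnd_adj_sym n d) (@Tnd_adj_irr n d).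

(* Main.v *)
Require Import Defs.
From mathcomp Require Import all_boot.
From mathcomp Require Import zify.

(** In a tree subtrees correspond to connected vertex sets, so count the latter.
    Fix a path P with d edges and build T from P by adding leaves v one at a
    time.  If the connected set B has k vertices off P and v is joined to u in
    B, then a connected set containing v is {v} or contains u.  When u = P i, a
    set of the second kind is determined by its trace on P, an interval around
    i, and by its part off P, an arbitrary set at worst; this gives at most
    (i + 1)(d + 1 - i) 2^k sets, and the first factor is maximal exactly at the
    middle of P.  When u is off P, the trace is empty or an interval around a
    fixed vertex while u itself is no longer a free choice, and the bound is
    strictly smaller.  Summing up gives the number of subtrees of T(n, d), and
    equality forces every vertex off P to be adjacent to the middle of P. *)

Set Implicit Arguments.
Unset Strict Implicit.
Unset Printing Implicit Defensive.

(** * Connected vertex sets of a graph *)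

Definition induced (G : sgraph) (S : {set G}) (u v : G) : bool :=
  [&& adj u v, u \in S & v \in S].
Arguments induced G S u v /.

Definition connected (G : sgraph) (S : {set G}) : bool :=
  [forall x in S, forall y in S, connect (induced S) x y].

Definition connected_sets (G : sgraph) : {set {set G}} :=
  [set S | (S != set0) && connected S].

Lemma mem_connected_sets (G : sgraph) (S : {set G}) :
  (S \in connected_sets G) = (S != set0) && connected S.
Proof. by rewrite /connected_sets inE. Qed.

Definition delete_edge (G : sgraph) (x y u v : G) : bool :=
  adj u v && ~~ ((u == x) && (v == y) || (u == y) && (v == x)).
Arguments delete_edge G x y u v /.

Lemma mem_edges (G : sgraph) (u v : G) : ([set u; v] \in edges G) = adj u v.
Proof.
rewrite inE; apply/existsP/idP=> [[x /existsP[y /andP[xy /eqP E]]]|uv]; last first.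
  by exists u; apply/existsP; exists v; rewrite uv eqxx.
have : u \in [set x; y] by rewrite -E set21.
have : v \in [set x; y] by rewrite -E set22.
have : x \in [set u; v] by rewrite E set21.
have : y \in [set u; v] by rewrite E set22.
by do 4![case/set2P=> ?]; subst; rewrite // adj_sym.
Qed.

Lemma induced_sym (G : sgraph) (S : {set G}) : symmetric (induced S).
Proof. by move=> x y; rewrite /= adj_sym [(x \in S) && _]andbC. Qed.

Lemma delete_edge_sym (G : sgraph) (x y : G) : symmetric (delete_edge x y).
Proof. by move=> u v; rewrite /= adj_sym orbC ![(u == _) && _]andbC. Qed.

Lemma connectedP (G : sgraph) (S : {set G}) :
  reflect {in S &, forall x y, connect (induced S) x y} (connected S).
Proof.
apply: (iffP forall_inP) => [h x y xS yS|h x xS].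
  exact: (forall_inP (h x xS)).
by apply/forall_inP=> y yS; apply: h.
Qed.

Lemma connected1 (G : sgraph) (x : G) : connected [set x].
Proof. by apply/connectedP=> y z /set1P-> /set1P->. Qed.

Lemma induced_mono (G : sgraph) (S S' : {set G}) :
  S \subset S' -> subrel (connect (induced S)) (connect (induced S')).
Proof.
move=> /subsetP sSS'; apply: connect_sub => x y /= /and3P[xy xS yS].
by apply: connect1; rewrite /= xy !sSS'.
Qed.

Lemma connected_setU1 (G : sgraph) (B : {set G}) (u v : G) :
  connected B -> u \in B -> adj v u -> connected (v |: B).
Proof.
move=> /connectedP cB uB vu.
have toU x : x \in v |: B -> connect (induced (v |: B)) x u.
  case/setU1P=> [->|xB]; first by apply: connect1; rewrite /= vu !inE eqxx uB orbT.
  by apply: induced_mono (cB _ _ xB uB); apply: subsetUr.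
apply/connectedP=> x y xB yB; apply: connect_trans (toU x xB) _.
by rewrite (sym_connect_sym (@induced_sym _ _)) toU.
Qed.

(** A connecting path has a first step that leaves [A]. Most edges used below are found in this
    way. *)
Lemma connect_exit (V : finType) (e : rel V) (A : {set V}) (x y : V) :
  connect e x y -> x \in A -> y \notin A ->
  exists a b, [/\ a \in A, b \notin A & e a b].
Proof.
case/connectP=> p; elim: p x => [|z p IH] x /=.
  by move=> _ -> ->.
case/andP=> xz zp yE xA yA; have [zA|zA] := boolP (z \in A).
  exact: (IH z).
by exists x, z.
Qed.

(** * Bridges, subtrees and their vertex sets *)

(** A connected set together with all edges inside it is a subtree, and distinct sets give distinct
    subtrees. This holds in any graph; it is the direction used for [Tnd n d]. *)
Lemma chi_ge_connected_sets (G : sgraph) : #|connected_sets G| <= chi G.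
Proof.
pose f (S : {set G}) := (S, [set E in edges G | E \subset S]).
have f_inj : injective f by move=> S S' [].
rewrite -(card_imset _ f_inj); apply/subset_leq_card/subsetP=> H.
case/imsetP=> S; rewrite mem_connected_sets => /andP[S0 /connectedP cS] -> {H}.
rewrite inE; apply/and3P; split=> //.
  apply/andP; split; first by apply/subsetP=> E; rewrite inE => /andP[].
  by apply/forall_inP=> E; rewrite inE => /andP[].
apply/forall_inP=> x xS; apply/forall_inP=> y yS.
apply: connect_sub (cS x y xS yS) => u v /= /and3P[uv uS vS].
apply: connect1; rewrite /= inE; apply/andP; split; last first.
  by rewrite subUset !sub1set uS.
by rewrite mem_edges.
Qed.

(** A path from [x] to [y] that avoids the edge [xy], made free of repetitions, would close up with
    that edge to a cycle on more than two vertices. *)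
Lemma tree_bridge (T : sgraph) (hT : is_tree T) (x y : T) :
  adj x y -> ~~ connect (delete_edge x y) x y.
Proof.
case: hT => _ _ acyc xy; apply/connectP=> -[p0 /shortenP[p pp up _] yE] {p0}.
have pa : path (@adj T) x p.
  by apply: sub_path pp => u v /= /andP[].
have : size (x :: p) <= 2.
  apply: acyc; rewrite /ucycle up andbT /= rcons_path pa -yE.
  by rewrite adj_sym.
case: p pp up yE {pa} => [|z [|//]] /=.
  by move=> _ _ yE; rewrite yE adj_irr in xy.
by move=> h _ yE; rewrite yE !eqxx andbF in h.
Qed.

(** If [d] and [d'] were different, the detour from [c] to [c'] inside [C], over the edge [c' d']
    and back to [d] inside [D] would bypass the bridge [c d]. *)
Lemma tree_edge_between (T : sgraph) (hT : is_tree T) (C D : {set T}) (c c' d d' : T) :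
  connected C -> connected D -> [disjoint C & D] ->
  c \in C -> c' \in C -> d \in D -> d' \in D -> adj c d -> adj c' d' -> d = d'.
Proof.
move=> /connectedP cC /connectedP cD CD xC xC' yD yD' cd cd'.
apply/eqP; apply: contraT => dd'; case/negP: (tree_bridge hT cd).
have nCD z : z \in C -> z \in D -> False.
  by move=> zC zD; rewrite (disjointFr CD zC) in zD.
have step : delete_edge c d c' d'.
  rewrite /= cd' [d' == d]eq_sym (negPf dd') andbF /=.
  apply/negP=> /andP[_ /eqP E]; apply: (nCD c) => //; by rewrite -E.
apply: (@connect_trans _ _ c'); last apply: connect_trans (connect1 step) _.
  apply: connect_sub (cC _ _ xC xC') => u v /and3P[uv uC vC].
  apply: connect1; rewrite /= uv /=; apply/negP.
  by case/orP=> /andP[/eqP E1 /eqP E2]; subst; [apply: (nCD d)|apply: (nCD d)].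
apply: connect_sub (cD _ _ yD' yD) => u v /and3P[uv uC vC].
apply: connect1; rewrite /= uv /=; apply/negP.
by case/orP=> /andP[/eqP E1 /eqP E2]; subst; apply: (nCD c).
Qed.

(** A missing edge [xy] with both ends in [H.1] would be bypassed by a path in [H.2], although it is
    a bridge. Hence a subtree is determined by its vertex set. *)
Lemma subtree_edges (T : sgraph) (hT : is_tree T) (H : {set T} * {set {set T}}) :
  is_subtree H -> H.2 = [set E in edges T | E \subset H.1].
Proof.
case/and3P=> /andP[/subsetP H2 /forall_inP H21] _ /forall_inP cH.
apply/setP=> E; rewrite inE; apply/idP/andP=> [EH|[]].
  by split; [apply: H2|apply: H21].
rewrite inE => /existsP[x /existsP[y /andP[xy /eqP->]]].
rewrite subUset !sub1set => /andP[xH yH].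
apply: contraT => xyH; case/negP: (tree_bridge hT xy).
apply: connect_sub (forall_inP (cH x xH) y yH) => u v /= uvH.
apply: connect1; rewrite /=; apply/andP; split.
  by rewrite -mem_edges H2.
apply: contra xyH; case/orP=> /andP[/eqP E1 /eqP E2]; subst=> //.
by rewrite setUC.
Qed.

Lemma tree_chi_le (T : sgraph) : is_tree T -> chi T <= #|connected_sets T|.
Proof.
move=> hT.
have inj1 : {in [set H | @is_subtree T H] &, injective fst}.
  move=> [S F] [S' F']; rewrite !inE => /(subtree_edges hT)/= -> /(subtree_edges hT)/= ->.
  by move=> ->.
rewrite /chi -(card_in_imset inj1).
apply/subset_leq_card/subsetP=> S /imsetP[H]; rewrite inE => hH -> {S}.
have E2 := subtree_edges hT hH; case/and3P: hH => _ H0 /forall_inP cH.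
rewrite mem_connected_sets H0; apply/connectedP=> x y xH yH.
apply: connect_sub (forall_inP (cH x xH) y yH) => u v /= uvH.
apply: connect1 => /=.
have : [set u; v] \in [set E in edges T | E \subset H.1] by rewrite -E2.
by rewrite inE mem_edges subUset !sub1set => /andP[-> /andP[-> ->]].
Qed.

(** * Intervals of path indices *)

Definition convex (d : nat) (X : {set 'I_d.+1}) : bool :=
  [forall i in X, forall k in X, forall j : 'I_d.+1, (i <= j <= k) ==> (j \in X)].

Lemma convexP (d : nat) (X : {set 'I_d.+1}) :
  reflect (forall i j k : 'I_d.+1, i \in X -> k \in X -> i <= j <= k -> j \in X) (convex X).
Proof.
apply: (iffP forall_inP) => [h i j k iX kX ijk|h i iX].
  exact: (implyP (forallP (forall_inP (h i iX) k kX) j)).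
by apply/forall_inP=> k kX; apply/forallP=> j; apply/implyP; apply: h.
Qed.

Definition intervals (d : nat) : {set {set 'I_d.+1}} :=
  [set X : {set 'I_d.+1} | (X != set0) && convex X].

Definition intervals_at (d : nat) (i : 'I_d.+1) : {set {set 'I_d.+1}} :=
  [set X : {set 'I_d.+1} | (i \in X) && convex X].

(** An interval around [i] is [[a, i + b]] with [a <= i] and [b <= d - i] chosen independently. *)
Lemma card_intervals_at (d : nat) (i : 'I_d.+1) :
  #|intervals_at i| = i.+1 * (d.+1 - i).
Proof.
pose f (ab : 'I_i.+1 * 'I_(d.+1 - i)) : {set 'I_d.+1} :=
  [set j : 'I_d.+1 | ab.1 <= j <= i + ab.2].
have f_inj : injective f.
  move=> [a b] [a' b'] /= E.
  have ilt := ltn_ord i; have alt := ltn_ord a; have blt := ltn_ord b.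
  have alt' := ltn_ord a'; have blt' := ltn_ord b'.
  have {}E (j : nat) : j <= d -> (a <= j <= i + b) = (a' <= j <= i + b').
    by move=> jd; have /setP/(_ (inord j)) := E; rewrite !inE /= !inordK.
  (* Comparing the two intervals at their four end points, all at most [d], forces [a = a'] and
     [b = b']. *)
  have E1 := E a; have E2 := E a'; have E3 := E (i + b); have E4 := E (i + b').
  by congr pair; apply: val_inj => /=; lia.
transitivity #|f @: setT|; last first.
  by rewrite card_imset // cardsT card_prod !card_ord.
congr #|pred_of_set _|; apply/setP=> X; rewrite inE; apply/andP/imsetP.
  case=> iX /convexP cX.
  have [a aX amin] := arg_minnP (fun j : 'I_d.+1 => j : nat) iX.
  have [b bX bmax] := arg_maxnP (fun j : 'I_d.+1 => j : nat) iX.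
  have {}bmax (j : 'I_d.+1) : j \in X -> j <= b := @bmax j.
  have ai : a < i.+1 by apply: amin.
  have ib : i <= b by apply: bmax.
  have bi : b - i < d.+1 - i by have := ltn_ord b; lia.
  exists (Ordinal ai, Ordinal bi) => //; apply/setP=> j; rewrite !inE /=.
  rewrite subnKC //; apply/idP/idP=> [jX|]; last exact: cX.
  by rewrite amin // bmax.
case=> -[a b] _ ->; rewrite inE /=; split.
  by have := ltn_ord a; rewrite ltnS => -> /=; apply: leq_addr.
apply/convexP=> j k l; rewrite !inE /=; lia.
Qed.

(** The factors of [i.+1 * (d.+1 - i)] have sum [d + 2], so the product is largest when they are
    closest. The maximum is attained at [c] and [d - c] only, and these coincide for even [d]. *)
Lemma intervals_at_center (d : nat) (i c : 'I_d.+1) :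
  c = (d.+1)./2 :> nat ->
  #|intervals_at i| < #|intervals_at c| \/
  #|intervals_at i| = #|intervals_at c| /\ (i = c \/ i + c = d :> nat).
Proof.
move=> cE; rewrite !card_intervals_at.
have ilt := ltn_ord i; have dE := odd_double_half d.+1.
have [->|ne] := eqVneq i c; first by right; split=> //; left.
have [e|ne'] := eqVneq (i + c) d; last left.
  right; split; last by right.
  have -> : d.+1 - i = c.+1 by lia.
  have -> : d.+1 - c = i.+1 by lia.
  by rewrite mulnC.
have {}ne : i <> c :> nat by move=> /val_inj /eqP; rewrite (negPf ne).
have : c + c = d \/ c + c = d.+1 by lia.
by case=> ?; nia.
Qed.

(** * Paths in a tree *)

(** Chords are not excluded here; in a tree [tree_path_adj] rules them out. *)
Record simple_path (G : sgraph) (d : nat) (P : 'I_d.+1 -> G) : Prop := SimplePath {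
  path_inj : injective P;
  path_adj : forall i j : 'I_d.+1, j = i.+1 :> nat -> adj (P i) (P j) }.

(** The relation [e] is tested only on the steps between [i] and [j], so that it may fail elsewhere
    on the path, as [delete_edge] does at its edge. *)
Lemma connect_along (V : finType) (d : nat) (e : rel V) (P : 'I_d.+1 -> V) (i j : 'I_d.+1) :
  i <= j ->
  (forall k l : 'I_d.+1, l = k.+1 :> nat -> i <= k -> l <= j -> e (P k) (P l)) ->
  connect e (P i) (P j).
Proof.
move=> /subnKC; move: (j - i) => m; elim: m j => [|m IH] j jE h.
  by have -> : i = j by apply: val_inj => /=; lia.
have jlt := ltn_ord j.
have lt : i + m < d.+1 by lia.
apply: (connect_trans (IH (Ordinal lt) erefl _)).
  by move=> k l lE ik /= lj; apply: h; lia.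
by apply/connect1/h => /=; lia.
Qed.

Lemma convex_connected (G : sgraph) (d : nat) (P : 'I_d.+1 -> G) (hP : simple_path P)
    (X : {set 'I_d.+1}) (S : {set G}) :
  convex X -> {in X, forall i, P i \in S} -> {in X &, forall i j, connect (induced S) (P i) (P j)}.
Proof.
move=> /convexP cX XS.
have le : {in X &, forall i j : 'I_d.+1, i <= j -> connect (induced S) (P i) (P j)}.
  move=> i j iX jX ij; apply: connect_along => // k l lE ik lj.
  by rewrite /= (path_adj hP lE) !XS //; apply: (cX i _ j) => //; lia.
move=> i j iX jX; case/orP: (leq_total i j) => [|ji]; first exact: le.
by rewrite (sym_connect_sym (@induced_sym _ _)) le.
Qed.

(** If [S] contains [P i] and [P k] but misses [P j] in between, a path in [S] from [P i] to [P k]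
    avoids every edge at [P j]. Together with two pieces of [P] it bypasses the bridge from [P j] to
    its successor. *)
Lemma tree_path_convex (T : sgraph) (hT : is_tree T) (d : nat) (P : 'I_d.+1 -> T)
    (hP : simple_path P) (S : {set T}) :
  connected S -> convex (P @^-1: S).
Proof.
move=> /connectedP cS; apply/convexP=> i j k; rewrite !inE => iS kS /andP[ij jk].
apply: contraT => jS.
have jnek : j != k by apply: contra jS => /eqP->.
have jlt : j < k by rewrite ltn_neqAle jk andbT.
have lt : j.+1 < d.+1 by have := ltn_ord k; lia.
pose j' := Ordinal lt; have jj' : adj (P j) (P j') by apply: (path_adj hP).
case/negP: (tree_bridge hT jj').
have sym := sym_connect_sym (@delete_edge_sym T (P j) (P j')).
have along (a b : 'I_d.+1) : a <= b -> b <= j \/ j < a ->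
    connect (delete_edge (P j) (P j')) (P a) (P b).
  move=> ab h; apply: connect_along => // m l lE am lb /=.
  rewrite (path_adj hP lE) !(inj_eq (path_inj hP)) -!val_eqE /=; lia.
apply: (@connect_trans _ _ (P i)); first by rewrite sym along //; left.
apply: (@connect_trans _ _ (P k)); last by rewrite sym along //; right.
apply: connect_sub (cS _ _ iS kS) => u v /= /and3P[uv uS vS].
apply: connect1; rewrite /= uv /=; apply/negP=> /orP[] /andP[/eqP ? /eqP ?]; subst.
  by rewrite uS in jS.
by rewrite vS in jS.
Qed.

(** The ends of a chord would form a connected set whose trace on the path has a gap. *)
Lemma tree_path_adj (T : sgraph) (hT : is_tree T) (d : nat) (P : 'I_d.+1 -> T)
    (hP : simple_path P) (i j : 'I_d.+1) :
  adj (P i) (P j) = (i.+1 == j :> nat) || (j.+1 == i :> nat).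
Proof.
have far (a b : 'I_d.+1) : a.+1 < b -> adj (P a) (P b) -> False.
  move=> ab Pab; have lt : a.+1 < d.+1 by have := ltn_ord b; lia.
  have cab : connected (P a |: [set P b]).
    by apply: connected_setU1 Pab; rewrite ?connected1 ?set11.
  have /convexP/(_ a (Ordinal lt) b) := tree_path_convex hT hP cab.
  rewrite !inE !eqxx orbT !(inj_eq (path_inj hP)).
  by rewrite -!val_eqE /=; lia.
apply/idP/orP=> [Pij|[/eqP|/eqP] E]; last 2 first.
- exact: (path_adj hP).
- by rewrite adj_sym; apply: (path_adj hP).
have ij : i <> j :> nat by move=> /val_inj E; rewrite E adj_irr in Pij.
have := far i j; have := far j i; rewrite Pij adj_sym Pij; lia.
Qed.

Definition path_vertices (G : sgraph) (d : nat) (P : 'I_d.+1 -> G) : {set G} :=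
  [set P i | i in setT].

Lemma path_verticesP (G : sgraph) (d : nat) (P : 'I_d.+1 -> G) (x : G) :
  reflect (exists i, x = P i) (x \in path_vertices P).
Proof. by apply: (iffP imsetP) => [[i _ ->]|[i ->]]; exists i. Qed.

Lemma mem_path_vertices (G : sgraph) (d : nat) (P : 'I_d.+1 -> G) (i : 'I_d.+1) :
  P i \in path_vertices P.
Proof. by apply/path_verticesP; exists i. Qed.

Lemma card_path_vertices (G : sgraph) (d : nat) (P : 'I_d.+1 -> G) :
  simple_path P -> #|path_vertices P| = d.+1.
Proof. by move=> hP; rewrite card_imset ?cardsT ?card_ord //; apply: path_inj. Qed.

Lemma path_vertices_connected (G : sgraph) (d : nat) (P : 'I_d.+1 -> G) :
  simple_path P -> connected (path_vertices P).
Proof.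
move=> hP; apply/connectedP=> x y /path_verticesP[i ->] /path_verticesP[j ->].
apply: (convex_connected hP (X := setT)); rewrite ?inE //.
  by apply/convexP=> *; rewrite inE.
by move=> k _; apply: mem_path_vertices.
Qed.

(** * Components off the path and the gate of a vertex *)

Definition component (G : sgraph) (A : {set G}) (u : G) : {set G} :=
  [set x | connect (induced A) u x].

(** The paths from [u] run in [A]; the point is that they stay in the component. A step leaving the
    set [D] of vertices reached inside [C] has both ends in [C], so it does not leave [D] after
    all. *)
Lemma component_connected (G : sgraph) (A : {set G}) (u : G) :
  connected (component A u).
Proof.
set C := component A u.
have reach x : x \in C -> connect (induced C) u x.
  move=> xC; pose D := [set y | connect (induced C) u y].
  suff : x \in D by rewrite inE.
  apply: contraT => xD; have ux : connect (induced A) u x by rewrite inE in xC.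
  have uD : u \in D by rewrite inE connect0.
  have [a [b [aD bD ab]]] := connect_exit ux uD xD.
  have [uC aC] : u \in C /\ a \in C.
    split; first by rewrite inE connect0.
    (* Unless [a] is [u], a path in [induced C] from [a] to [u] has a first step, which puts [a] in
       [C]. *)
    have [->|ua] := eqVneq a u; first by rewrite inE connect0.
    move: aD; rewrite inE (sym_connect_sym (@induced_sym _ _)).
    by case/connectP=> -[|z p] /= => [_ E|/andP[/and3P[]] //]; rewrite E eqxx in ua.
  have bC : b \in C.
    by rewrite inE; rewrite inE in aC; apply: connect_trans aC (connect1 ab).
  case/negP: bD; rewrite inE; rewrite inE in aD.
  apply: connect_trans aD (connect1 _).
  by case/and3P: ab => /= -> _ _; rewrite aC bC.
apply/connectedP=> x y xC yC; apply: connect_trans (reach y yC).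
by rewrite (sym_connect_sym (@induced_sym _ _)) reach.
Qed.

Lemma component_sub (G : sgraph) (A : {set G}) (u : G) :
  u \in A -> component A u \subset A.
Proof.
move=> uA; apply/subsetP=> x; rewrite inE => ux; apply: contraT => xA.
by have [a [b [_ bA /and3P[_ _]]]] := connect_exit ux uA xA; rewrite (negPf bA).
Qed.

(* [P i] is the vertex through which u is connected to the path. *)
Lemma tree_gate (T : sgraph) (hT : is_tree T) (d : nat) (P : 'I_d.+1 -> T)
    (hP : simple_path P) (u : T) :
  u \notin path_vertices P ->
  exists i, forall S : {set T}, connected S -> u \in S ->
    P @^-1: S \in set0 |: intervals_at i.
Proof.
move=> uQ; set Q := path_vertices P in uQ *; pose C := component (~: Q) u.
have cC : connected C by apply: component_connected.
have CQ : [disjoint C & Q].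
  by rewrite disjoints_subset component_sub // inE.
have uC : u \in C by rewrite inE connect0.
(* The first step of [S] out of [C] ends on the path: a vertex off the path adjacent to [C] would
   belong to [C]. *)
have entry (S : {set T}) i : connected S -> u \in S -> P i \in S ->
    exists2 j, P j \in S & exists2 a, a \in C & adj a (P j).
  move=> /connectedP cS uS iS.
  have iC : P i \notin C by rewrite (disjointFl CQ) // mem_path_vertices.
  have [a [b [aC bC /and3P[ab aS bS]]]] := connect_exit (cS _ _ uS iS) uC iC.
  suff : b \in Q by case/path_verticesP=> j E; subst b; exists j => //; exists a.
  apply: contraT => bQ; case/negP: bC; rewrite inE; have aC' := aC.
  rewrite inE in aC; apply: connect_trans aC (connect1 _).
  by rewrite /= ab !inE bQ (disjointFr CQ aC').
have [/existsP[i /existsP[a /andP[aC ai]]]|none] :=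
  boolP [exists i, exists a, (a \in C) && adj a (P i)].
  exists i => S cS uS; rewrite !inE.
  rewrite (tree_path_convex hT hP cS) andbT.
  have [//|/set0Pn[k]] := eqVneq (P @^-1: S) set0; rewrite inE => kS /=.
  have [j jS [b bC bj]] := entry S k cS uS kS.
  suff -> : P i = P j by [].
  exact: (tree_edge_between hT cC (path_vertices_connected hP) CQ aC bC
            (mem_path_vertices P i) (mem_path_vertices P j) ai bj).
(* Without an edge from [C] to the path every trace is empty, and [ord0] is an arbitrary choice. *)
exists ord0 => S cS uS; rewrite !inE; apply/orP; left; apply/eqP/setP=> k.
rewrite !inE; apply/negP=> kS; have [j jS [b bC bj]] := entry S k cS uS kS.
by case/negP: none; apply/existsP; exists j; apply/existsP; exists b; rewrite bC.
Qed.

(** * Counting the connected sets that contain a new vertex *)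

(** In use, [Z] is the part common to all the sets that are coded: the new vertex, with its
    neighbour if that lies off the path. *)
Lemma trace_inj (G : sgraph) (d : nat) (P : 'I_d.+1 -> G) (Z S S' : {set G}) :
  Z \subset S -> Z \subset S' -> P @^-1: S = P @^-1: S' ->
  S :\: (Z :|: path_vertices P) = S' :\: (Z :|: path_vertices P) -> S = S'.
Proof.
move=> /subsetP ZS /subsetP ZS' /setP EP /setP ED; apply/setP=> x.
have [xZ|xZ] := boolP (x \in Z); first by rewrite ZS // ZS'.
have [/path_verticesP[i ->]|xQ] := boolP (x \in path_vertices P).
  by have := EP i; rewrite !inE.
by have := ED x; rewrite !inE (negPf xZ) (negPf xQ).
Qed.

Definition connected_sets_in (G : sgraph) (B : {set G}) : {set {set G}} :=
  [set S in connected_sets G | S \subset B].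

Definition new_sets (G : sgraph) (B : {set G}) (v : G) : {set {set G}} :=
  [set S in connected_sets_in (v |: B) | v \in S].

Lemma mem_new_sets (G : sgraph) (B : {set G}) (v : G) (S : {set G}) :
  (S \in new_sets B v) = [&& connected S, v \in S & S \subset v |: B].
Proof.
rewrite /new_sets /connected_sets_in !(in_set, mem_connected_sets).
have [vS|] := boolP (v \in S); last by rewrite !andbF.
have -> : S != set0 by apply/set0Pn; exists v.
by rewrite andbT.
Qed.

Lemma card_connected_sets_setU1 (G : sgraph) (B : {set G}) (v : G) : v \notin B ->
  #|connected_sets_in (v |: B)| = #|connected_sets_in B| + #|new_sets B v|.
Proof.
move=> vB; rewrite -(cardsID [set S : {set G} | v \in S]) addnC; congr (_ + _).
  apply: eq_card => S; rewrite /connected_sets_in !(in_set, mem_connected_sets).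
  rewrite andbCA; congr (_ && _); apply/andP/idP=> [[vS /subsetP SB]|SB].
    apply/subsetP=> x xS; have := SB x xS; rewrite in_setU1 => /predU1P[E|//].
    by rewrite -E xS in vS.
  split; last by apply: subset_trans SB (subsetUr _ _).
  by apply: contra vB; apply: (subsetP SB).
by apply: eq_card => S; rewrite /new_sets !in_set.
Qed.

(** A path in [S] leaving [v] enters [B], and [u] is the only neighbour of [v] in the connected set
    [B]. *)
Lemma new_sets_mem (T : sgraph) (hT : is_tree T) (B : {set T}) (v u : T)
    (S : {set T}) :
  connected B -> v \notin B -> u \in B -> adj v u ->
  S \in new_sets B v -> S != [set v] -> u \in S.
Proof.
move=> cB vB uB vu; rewrite mem_new_sets => /and3P[/connectedP cS vS /subsetP SB] Sv.
have [y yS yv] : exists2 y, y \in S & y \notin [set v].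
  apply/subsetPn; apply: contra Sv => Sv.
  by rewrite eqEsubset Sv sub1set.
have [a [b [/set1P-> bv /and3P[ab aS bS]]]] := connect_exit (cS _ _ vS yS) (set11 v) yv.
have bB : b \in B by have := SB b bS; rewrite in_setU1; rewrite in_set1 in bv; rewrite (negPf bv).
have dis : [disjoint [set v] & B] by rewrite disjoints1.
by rewrite (tree_edge_between hT (connected1 v) cB dis (set11 v) (set11 v) uB bB vu ab).
Qed.

(** The summand 1 stands for [[set v]]. Every other new set contains [P i] and is coded by its trace
    and by a subset of the [k] vertices of [B] off the path. Strictness comes from a pair that no
    set attains. *)
Lemma card_new_sets_on_path (T : sgraph) (hT : is_tree T) (d k : nat)
    (P : 'I_d.+1 -> T) (hP : simple_path P) (B : {set T}) (v : T) (i : 'I_d.+1) :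
  connected B -> path_vertices P \subset B -> #|B| = d.+1 + k ->
  v \notin B -> adj v (P i) ->
  #|new_sets B v| < 1 + #|intervals_at i| * 2 ^ k \/
  #|new_sets B v| <= 1 + #|intervals_at i| * 2 ^ k /\
    {in B :\: path_vertices P, forall w, adj w (P i)}.
Proof.
set Q := path_vertices P => cB QB cardB vB vu.
have uB : P i \in B by apply: (subsetP QB); apply: mem_path_vertices.
pose f (S : {set T}) := (P @^-1: S, S :\: ([set v] :|: Q)).
pose F := new_sets B v :\ [set v].
pose R := setX (intervals_at i) (powerset (B :\: Q)).
have f_inj : {in F &, injective f}.
  move=> S S'; rewrite !in_setD1 !mem_new_sets.
  move=> /andP[_ /and3P[_ vS _]] /andP[_ /and3P[_ vS' _]] [].
  by apply: trace_inj; rewrite sub1set.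
have fR : f @: F \subset R.
  apply/subsetP=> _ /imsetP[S SF ->]; move: (SF); rewrite in_setD1 => /andP[Sv Snew].
  have iS := new_sets_mem hT cB vB uB vu Snew Sv.
  move: Snew; rewrite mem_new_sets => /and3P[cS vS /subsetP SB].
  rewrite inE /= [in X in X && _]inE inE iS (tree_path_convex hT hP cS) inE /=.
  apply/subsetP=> x; rewrite !inE negb_or => /andP[/andP[xv ->] /SB].
  by rewrite !inE (negPf xv).
have cardR : #|R| = #|intervals_at i| * 2 ^ k.
  rewrite cardsX card_powerset cardsD (setIidPr QB) cardB card_path_vertices //.
  by rewrite addKn.
have cardF : #|new_sets B v| <= 1 + #|F|.
  by rewrite (cardsD1 [set v]) leq_add2r leq_b1.
rewrite -(card_in_imset f_inj) in cardF; rewrite -cardR.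
have [/forall_inP star|] := boolP [forall w in B :\: Q, adj w (P i)].
  by right; split=> //; apply: leq_trans cardF _; rewrite leq_add2l subset_leq_card.
case/forall_inPn=> w; rewrite inE => /andP[wQ wB] wu; left.
(* The pair ({i}, {w}) is not attained: {v, P i, w} is not connected. *)
apply: leq_ltn_trans cardF _; rewrite ltn_add2l; apply: proper_card.
apply/properP; split=> //; exists ([set i], [set w]).
  rewrite !inE /= eqxx; apply/andP; split; last by rewrite sub1set !inE wQ.
  by apply/convexP=> a b c /set1P-> /set1P-> h; rewrite inE -val_eqE /=; lia.
apply/negP=> /imsetP[S SF [/setP EP /setP ED]]; move: (SF); rewrite in_setD1 => /andP[Sv Snew].
have iS := new_sets_mem hT cB vB uB vu Snew Sv.
move: Snew; rewrite mem_new_sets => /and3P[/connectedP cS vS SB].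
have wS : w \in S by have := ED w; rewrite !inE eqxx => /esym/andP[].
have uw : P i \notin [set w].
  by rewrite inE; apply: contra wQ => /eqP <-; apply: mem_path_vertices.
(* A path in [S] from [w] to [P i] would start with an edge to [P i], excluded by the choice of [w],
   or to [v], whose only neighbour in [B] is [P i]. *)
have [a [b [/set1P-> bw /and3P[wb _ bS]]]] := connect_exit (cS _ _ wS iS) (set11 w) uw.
have := ED b; rewrite in_set1 in bw; rewrite !inE bS (negPf bw) andbT.
move/esym/negbFE/orP=> [/eqP bv|/path_verticesP[j bE]]; last first.
  have := EP j; rewrite !inE -bE bS => /eqP ji.
  by rewrite bE ji (negPf wu) in wb.
subst b; have dis : [disjoint [set v] & B] by rewrite disjoints1.
rewrite adj_sym in wb.
have E := tree_edge_between hT (connected1 v) cB dis (set11 v) (set11 v) uB wB vu wb.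
by rewrite -E mem_path_vertices in wQ.
Qed.

(** Every new set but [[set v]] contains [u], so only [k.-1] vertices off the path remain free. The
    trace is governed by the gate [i] of [u]; the 1 inside the factor is the empty trace. *)
Lemma card_new_sets_off_path (T : sgraph) (hT : is_tree T) (d k : nat)
    (P : 'I_d.+1 -> T) (hP : simple_path P) (B : {set T}) (v u : T) :
  connected B -> path_vertices P \subset B -> #|B| = d.+1 + k ->
  v \notin B -> u \in B -> u \notin path_vertices P -> adj v u ->
  0 < k /\ exists i : 'I_d.+1, #|new_sets B v| <= 1 + (1 + #|intervals_at i|) * 2 ^ k.-1.
Proof.
set Q := path_vertices P => cB QB cardB vB uB uQ vu.
have cardQ : #|B :\: Q| = k.
  by rewrite cardsD (setIidPr QB) cardB card_path_vertices // addKn.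
have uBQ : u \in B :\: Q by rewrite inE uQ.
have [i gate] := tree_gate hT hP uQ.
split; first by rewrite -cardQ; apply/card_gt0P; exists u.
exists i.
pose f (S : {set T}) := (P @^-1: S, S :\: ([set v; u] :|: Q)).
pose F := new_sets B v :\ [set v].
pose R := setX (set0 |: intervals_at i) (powerset (B :\: Q :\ u)).
have cardF : #|new_sets B v| <= 1 + #|F|.
  by rewrite (cardsD1 [set v]) leq_add2r leq_b1.
apply: leq_trans cardF _; rewrite leq_add2l.
have uF S : S \in F -> u \in S.
  by rewrite in_setD1 => /andP[Sv Snew]; apply: (new_sets_mem hT cB vB uB vu Snew).
have f_inj : {in F &, injective f}.
  move=> S S' SF S'F; have uS := uF _ SF; have uS' := uF _ S'F.
  move: SF S'F; rewrite !in_setD1 !mem_new_sets.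
  move=> /andP[_ /and3P[_ vS _]] /andP[_ /and3P[_ vS' _]] [].
  by apply: trace_inj; rewrite subUset !sub1set ?vS ?vS'.
have fR : f @: F \subset R.
  apply/subsetP=> _ /imsetP[S SF ->]; have uS := uF S SF.
  move: SF; rewrite in_setD1 mem_new_sets => /andP[_ /and3P[cS vS /subsetP SB]].
  rewrite inE /= gate //= inE.
  apply/subsetP=> x; rewrite !inE !negb_or => /andP[/andP[/andP[xv ->] ->] /SB].
  by rewrite !inE (negPf xv).
have cardR : #|R| = (1 + #|intervals_at i|) * 2 ^ k.-1.
  rewrite cardsX card_powerset cardsU1 !inE /=.
  have := cardsD1 u (B :\: Q); by rewrite uBQ cardQ => ->.
by rewrite -cardR -(card_in_imset f_inj) subset_leq_card.
Qed.

(** Both [c] and [d - c] are allowed as centre: for odd [d] they are the two middle vertices,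
    exchanged by reversing the path. *)
Definition star_at (T : sgraph) (d : nat) (P : 'I_d.+1 -> T) (c : 'I_d.+1) (B : {set T}) :=
  exists2 i : 'I_d.+1, i = c \/ i + c = d :> nat &
    {in B :\: path_vertices P, forall w, adj w (P i)}.

(** The bound is strict if [u] is off the path or does not maximise the interval count. Otherwise
    the star comes from the count on the path, and [v] joins it as a neighbour of [u]. *)
Lemma card_new_sets (T : sgraph) (hT : is_tree T) (d k : nat) (hd : 1 < d)
    (P : 'I_d.+1 -> T) (hP : simple_path P) (c : 'I_d.+1) (hc : c = (d.+1)./2 :> nat)
    (B : {set T}) (v u : T) :
  connected B -> path_vertices P \subset B -> #|B| = d.+1 + k ->
  v \notin B -> u \in B -> adj v u ->
  #|new_sets B v| < 1 + #|intervals_at c| * 2 ^ k \/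
  #|new_sets B v| <= 1 + #|intervals_at c| * 2 ^ k /\ star_at P c (v |: B).
Proof.
move=> cB QB cardB vB uB vu; have k2 : 0 < 2 ^ k by rewrite expn_gt0.
have [/path_verticesP[i uE]|uQ] := boolP (u \in path_vertices P); last first.
  left; have [k0 [i]] := card_new_sets_off_path hT hP cB QB cardB vB uB uQ vu.
  have le : #|intervals_at i| <= #|intervals_at c|.
    by case: (intervals_at_center i hc) => [/ltnW|[->]].
  (* With [N] for the count at [c], the bound [(1 + N) * 2 ^ k.-1] is below [N * 2 ^ k] as soon as
     [1 < N]. *)
  have c2 : 1 < #|intervals_at c|.
    by rewrite card_intervals_at hc; have := odd_double_half d.+1; nia.
  rewrite -{2}(prednK k0) expnS; have : 0 < 2 ^ k.-1 by rewrite expn_gt0.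
  by nia.
subst u; have on := card_new_sets_on_path hT hP cB QB cardB vB vu.
case: (intervals_at_center i hc) => [lt|[E ic]].
  by left; case: on => [|[]]; nia.
rewrite E in on; case: on => [|[le star]]; [by left|right; split=> //].
exists i => // w; rewrite !inE => /andP[wQ /predU1P[->//|wB]].
by apply: star; rewrite inE wQ.
Qed.

(** * Growing the tree from a path *)

Lemma card_connected_sets_path (T : sgraph) (hT : is_tree T) (d : nat)
    (P : 'I_d.+1 -> T) (hP : simple_path P) :
  #|connected_sets_in (path_vertices P)| <= #|intervals d|.
Proof.
have inj : {in connected_sets_in (path_vertices P) &,
    injective (fun S : {set T} => P @^-1: S)}.
  have E S : S \in connected_sets_in (path_vertices P) -> S = P @: (P @^-1: S).
    rewrite /connected_sets_in inE => /andP[_ /subsetP SQ]; apply/setP=> x.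
    apply/idP/imsetP=> [xS|[i]]; last by rewrite inE => iS ->.
    by have /path_verticesP[i xE] := SQ x xS; exists i; rewrite // inE -xE.
  by move=> S S' /E {2}-> /E {2}-> ->.
rewrite -(card_in_imset inj); apply/subset_leq_card/subsetP=> _ /imsetP[S + ->].
rewrite /connected_sets_in inE mem_connected_sets => /andP[/andP[/set0Pn[x xS] cS] /subsetP SQ].
rewrite inE (tree_path_convex hT hP cS) andbT.
by have /path_verticesP[i xE] := SQ x xS; apply/set0Pn; exists i; rewrite inE -xE.
Qed.

(** The bounds [1 + N * 2 ^ j] for [j < k], with [N] the count at [c], sum to [k + N * (2 ^ k - 1)];
    adding [N] on the left avoids the subtraction. *)
Lemma tree_grow (T : sgraph) (hT : is_tree T) (d : nat) (hd : 1 < d)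
    (P : 'I_d.+1 -> T) (hP : simple_path P) (c : 'I_d.+1) (hc : c = (d.+1)./2 :> nat)
    (k : nat) :
  d.+1 + k <= #|T| ->
  exists B : {set T}, [/\ connected B, path_vertices P \subset B, #|B| = d.+1 + k &
    #|connected_sets_in B| + #|intervals_at c| <
      #|intervals d| + k + #|intervals_at c| * 2 ^ k \/
    #|connected_sets_in B| + #|intervals_at c| <=
      #|intervals d| + k + #|intervals_at c| * 2 ^ k /\ star_at P c B].
Proof.
elim: k => [|k IH] hk.
  exists (path_vertices P); rewrite addn0 muln1; split=> //.
  - exact: path_vertices_connected.
  - exact: card_path_vertices.
  right; split; first by rewrite addn0 leq_add2r card_connected_sets_path.
  by exists c; [left|move=> w; rewrite setDv inE].
have [|B [cB QB cardB bound]] := IH; first by lia.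
have [w wB] : exists w, w \notin B.
  apply/existsP; rewrite -negb_forall; apply/negP=> /forallP allB.
  have : #|T| <= d.+1 + k.
    by rewrite -cardB -cardsT subset_leq_card //; apply/subsetP=> x _; apply: allB.
  by lia.
have PB : P ord0 \in B by apply: (subsetP QB); apply: mem_path_vertices.
have [u [v [uB vB uv]]] : exists u v, [/\ u \in B, v \notin B & adj u v].
  by case: hT => _ conn _; apply: connect_exit (conn (P ord0) w) PB wB.
rewrite adj_sym in uv.
have new := card_new_sets hT hd hP hc cB QB cardB vB uB uv.
exists (v |: B); split.
- exact: connected_setU1 cB uB uv.
- exact: subset_trans QB (subsetUr _ _).
- by rewrite cardsU1 vB cardB; lia.
rewrite card_connected_sets_setU1 // expnS.
case: new => [lt|[le star]]; first by left; case: bound => [|[]]; nia.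
(* The vertex added last already yields the star on all of [v |: B], so the star on [B] is
   dropped. *)
by case: bound => [|[lt _]]; [left|right; split=> //]; nia.
Qed.

(** * Recognising T(n, d) *)

Lemma simple_path_rev (G : sgraph) (d : nat) (P : 'I_d.+1 -> G) :
  simple_path P -> simple_path (P \o @rev_ord d.+1).
Proof.
move=> hP; split; first exact: inj_comp (path_inj hP) rev_ord_inj.
move=> i j ij /=; rewrite adj_sym; apply: (path_adj hP) => /=.
by have := ltn_ord j; lia.
Qed.

(** A vertex off the path has no second neighbour on it, and two adjacent ones would form a triangle
    with [P c]. So all adjacencies are those of [Tnd n d]. *)
Lemma isomorphic_Tnd (T : sgraph) (hT : is_tree T) (d n : nat)
    (P : 'I_d.+1 -> T) (hP : simple_path P) (c : 'I_d.+1) (hc : c = (d.+1)./2 :> nat) :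
  #|T| = n -> {in ~: path_vertices P, forall w, adj w (P c)} -> isomorphic T (Tnd n d).
Proof.
set Q := path_vertices P => hn star.
have leaf i w : w \notin Q -> adj w (P i) = (i == (d.+1)./2 :> nat).
  rewrite -hc val_eqE => wQ; apply/idP/eqP=> [wi|->]; last by rewrite star // inE.
  apply: (path_inj hP).
  have dis : [disjoint [set w] & Q] by rewrite disjoints1.
  apply: (tree_edge_between hT (connected1 w) (path_vertices_connected hP) dis
    (set11 w) (set11 w) (mem_path_vertices P i) (mem_path_vertices P c) wi).
  by rewrite star // inE.
have leaves w w' : w \notin Q -> w' \notin Q -> adj w w' = false.
  move=> wQ wQ'; apply/negP=> ww'.
  have wc : adj w (P c) by rewrite star // inE.
  have wc' : adj (P c) w' by rewrite adj_sym star // inE.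
  have cw : connected (P c |: [set w']) by apply: connected_setU1 wc'; rewrite ?connected1 ?set11.
  have nw : P c != w by apply: contra wQ => /eqP<-; apply: mem_path_vertices.
  have dis : [disjoint [set w] & P c |: [set w']].
    rewrite disjoints1 !inE negb_or eq_sym nw; apply/eqP=> E.
    by rewrite E adj_irr in ww'.
  have E := tree_edge_between hT (connected1 w) cw dis (set11 w) (set11 w)
    (setU11 _ _) (setU1r _ (set11 w')) wc ww'.
  by rewrite E adj_irr in wc'.
have cardQ : n - d.+1 = #|~: Q| by rewrite cardsCs setCK hn card_path_vertices.
(* The map is built from [Tnd n d] to [T], where it is a case analysis; the isomorphism is its
   inverse. *)
pose g (x : Tnd n d) : T :=
  match x with inl i => P i | inr j => enum_val (cast_ord cardQ j) end.
have gr j : g (inr j) \notin Q by have := enum_valP (cast_ord cardQ j); rewrite inE.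
have gl i : g (inl i) \in Q by apply: mem_path_vertices.
have g_inj : injective g.
  move=> [i|j] [i'|j'] E.
  - by rewrite (path_inj hP E).
  - by have := gl i; rewrite E (negPf (gr j')).
  - by have := gl i'; rewrite -E (negPf (gr j)).
  - by rewrite (cast_ord_inj (enum_val_inj E)).
have dn : d.+1 <= n by rewrite -hn -(card_path_vertices hP) max_card.
have card_eq : #|T| = #|Tnd n d| by rewrite hn card_sum !card_ord subnKC.
have g_bij : bijective g by apply: inj_card_bij; rewrite // card_eq.
case: g_bij => f fK gK; exists f; split; first by exists g.
have gadj x y : adj (g x) (g y) = adj x y.
  case: x y => [i|j] [i'|j'].
  - exact: tree_path_adj.
  - by rewrite adj_sym leaf ?gr.
  - by rewrite leaf ?gr.
  - by rewrite leaves ?gr.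
by move=> x y; rewrite -gadj !gK.
Qed.

(** If the star is centred at [d - c], reversing the path moves its centre to index [c]. *)
Lemma star_at_isomorphic_Tnd (T : sgraph) (hT : is_tree T) (d n : nat)
    (P : 'I_d.+1 -> T) (hP : simple_path P) (c : 'I_d.+1) (hc : c = (d.+1)./2 :> nat) :
  #|T| = n -> star_at P c setT -> isomorphic T (Tnd n d).
Proof.
move=> hn [i ic star].
have {}star : {in ~: path_vertices P, forall w, adj w (P i)}.
  by move=> w; rewrite -setTD; apply: star.
case: ic => [ic|ic]; first by subst i; apply: (isomorphic_Tnd hT hP hc).
apply: (isomorphic_Tnd hT (simple_path_rev hP) hc) => // w wP /=.
have -> : rev_ord c = i by apply: val_inj => /=; lia.
apply: star; move: wP; rewrite !inE; apply: contra => /path_verticesP[j ->].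
by apply/path_verticesP; exists (rev_ord j); rewrite /= rev_ordK.
Qed.

(** * Lower bound for T(n, d) *)

(** Three disjoint families of connected sets suffice: intervals missing [c], intervals around [c]
    with any set of leaves, and single leaves. They are [R1], [R2] and [R3] below. *)
Lemma card_connected_sets_Tnd (d n : nat) (c : 'I_d.+1) (hc : c = (d.+1)./2 :> nat) :
  #|intervals d| + (n - d.+1) + #|intervals_at c| * 2 ^ (n - d.+1) <=
  #|connected_sets (Tnd n d)| + #|intervals_at c|.
Proof.
pose J := 'I_(n - d.+1).
pose f (XY : {set 'I_d.+1} * {set J}) : {set Tnd n d} :=
  [set z | match z with inl i => i \in XY.1 | inr j => j \in XY.2 end].
have f_inj : injective f.
  move=> [X Y] [X' Y'] /setP E; congr pair; apply/setP=> z.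
    by have := E (inl z); rewrite !inE.
  by have := E (inr z); rewrite !inE.
have spine : simple_path (inl : 'I_d.+1 -> Tnd n d).
  by split=> [i j [] //|i j /= ->]; rewrite eqxx.
have sub_at : intervals_at c \subset intervals d.
  by apply/subsetP=> X; rewrite !inE => /andP[cX ->]; rewrite andbT; apply/set0Pn; exists c.
pose R1 : {set {set 'I_d.+1} * {set J}} := setX (intervals d :\: intervals_at c) [set set0].
pose R2 : {set {set 'I_d.+1} * {set J}} := setX (intervals_at c) setT.
pose R3 : {set {set 'I_d.+1} * {set J}} := setX [set set0] [set [set j] | j : J].
have cR1 : #|R1| = #|intervals d| - #|intervals_at c|.
  by rewrite cardsX cards1 muln1 cardsD (setIidPr sub_at).
have cR2 : #|R2| = #|intervals_at c| * 2 ^ (n - d.+1).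
  by rewrite cardsX -powersetT card_powerset cardsT card_ord.
have cR3 : #|R3| = n - d.+1.
  by rewrite cardsX cards1 mul1n card_imset ?card_ord //; apply: set1_inj.
have d12 : R1 :&: R2 = set0.
  apply/setP=> -[X Y]; rewrite !inE /=; by case: (c \in X); case: (convex X); rewrite ?andbF.
have d3 : (R1 :|: R2) :&: R3 = set0.
  apply/setP=> -[X Y]; rewrite !inE /=; have [->|] := eqVneq X set0.
    by rewrite !inE.
  by rewrite andbF.
have conn_f XY : XY \in R1 :|: R2 :|: R3 -> f XY \in connected_sets (Tnd n d).
  rewrite mem_connected_sets.
  have in_f1 (X : {set 'I_d.+1}) (Y : {set J}) : {in X, forall i, inl i \in f (X, Y)}.
    by move=> i iX; rewrite inE.
  case: XY => X Y /setUP[/setUP[]|]; rewrite in_setX /=.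
  - rewrite !inE => /andP[/andP[_ /andP[/set0Pn[i iX] cX]] /eqP->]; apply/andP; split.
      by apply/set0Pn; exists (inl i); rewrite inE.
    apply/connectedP=> -[x|x] [y|y]; rewrite !inE //= => xX yX.
    exact: (convex_connected spine cX).
  - rewrite !inE andbT => /andP[cX convX]; apply/andP; split.
      by apply/set0Pn; exists (inl c); rewrite inE.
    have toc x : x \in f (X, Y) -> connect (induced (f (X, Y))) x (inl c).
      case: x => x; rewrite inE /= => xX; last first.
        by apply: connect1; rewrite /= !inE /= xX cX hc eqxx.
      exact: (convex_connected spine convX).
    apply/connectedP=> x y xS yS; apply: connect_trans (toc x xS) _.
    by rewrite (sym_connect_sym (@induced_sym _ _)) toc.
  - move=> /andP[/set1P-> /imsetP[j _ ->]]; apply/andP; split.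
      by apply/set0Pn; exists (inr j); rewrite !inE.
    apply/connectedP=> -[x|x] [y|y]; rewrite !inE //= => /eqP-> /eqP->.
    exact: connect0.
have : #|f @: (R1 :|: R2 :|: R3)| <= #|connected_sets (Tnd n d)|.
  by apply/subset_leq_card/subsetP=> _ /imsetP[XY XYR ->]; apply: conn_f.
rewrite card_imset // cardsU d3 cards0 subn0 cardsU d12 cards0 subn0 cR1 cR2 cR3.
have := subset_leq_card sub_at; lia.
Qed.

(** * Paths of prescribed length and comparison of the counts *)

(** Some path has at least [d] edges, and its first [d.+1] vertices are kept. *)
Lemma diameter_simple_path (G : sgraph) (d : nat) : 0 < d -> d <= diameter G ->
  exists P : 'I_d.+1 -> G, simple_path P.
Proof.
move=> d0 dG.
have [k kP dk] : exists2 k : 'I_#|G|, [exists x : G, exists t : k.-tuple G,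
    path (@adj G) x t && uniq (x :: t)] & d <= k.
  apply/exists_inP; apply: contraLR dG => /exists_inPn h.
  (* Otherwise every term of the maximum is at most [d.-1]; as [d] is positive, this also covers an
     empty maximum, which is 0. *)
  rewrite -ltnNge -(prednK d0) ltnS; apply/bigmax_leqP=> k kP.
  by have := h k kP; lia.
case/existsP: kP => x /existsP[t /andP[pt ut]].
exists (fun i : 'I_d.+1 => nth x (x :: t) i); split=> [i j|i j ij].
  move/eqP; rewrite nth_uniq //= ?size_tuple; first by move/eqP/val_inj.
    by apply: leq_trans (ltn_ord i) _; rewrite ltnS.
  by apply: leq_trans (ltn_ord j) _; rewrite ltnS.
have := pathP x pt i; rewrite size_tuple ij; apply.
by have := ltn_ord j; lia.
Qed.

Theorem theorem3p7 (d n : nat) (T : sgraph) (hd : 1 < d) (hT : is_tree T)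
    (hn : #|T| = n) (hdiam : d <= diameter T)
    (hiso : ~ isomorphic T (Tnd n d)) :
  chi T < chi (Tnd n d).
Proof.
have [P hP] := diameter_simple_path (ltnW hd) hdiam.
pose c : 'I_d.+1 := inord (d.+1)./2.
have hc : c = (d.+1)./2 :> nat by rewrite inordK //; lia.
have dn : d.+1 <= #|T| by rewrite -(card_path_vertices hP) max_card.
have [|B [_ _ cardB bound]] := tree_grow hT hd hP hc (k := n - d.+1).
  by rewrite -hn subnKC.
have BT : B = setT.
  apply/eqP; rewrite eqEcard subsetT cardsT cardB subnKC -hn; [exact: leqnn|exact: dn].
have all_in : connected_sets_in B = connected_sets T.
  by apply/setP=> S; rewrite /connected_sets_in inE BT subsetT andbT.
rewrite all_in BT in bound.
apply: leq_ltn_trans (tree_chi_le hT) _; apply: leq_trans (chi_ge_connected_sets _).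
have lower := @card_connected_sets_Tnd d n c hc.
(* The non-strict alternative carries a star on all of [T], hence an isomorphism with [Tnd n d],
   which is excluded. *)
case: bound => [|[_ /(star_at_isomorphic_Tnd hT hP hc hn)//]].
by lia.
Qed.
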